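(* For the odd cycle $C_{2k+1}$ ($k\ge1$), $$\mathrm{def}(C_{2k+1})=1=\ell(\mathcal A(C_{2k+1})).$$ On the other hand, the spectral lower bound $\ell(\mathcal A(G))\ge\mathrm{spec}(G)$ takes, for $G=C_{2k+1}$, the form $$\ell(\mathcal A(C_{2k+1}))\ \ge\ \mathrm{spec}(C_{2k+1})=\frac{2k+1}{2}\left(1-\cos\frac{\pi}{2k+1}\right),$$ and hence $\mathrm{spec}(C_{2k+1})$ tends to $0$ as $k\to\infty$.
   Context: For a finite simple graph $G$ on $n$ vertices, $\mathrm{spec}(G):=\frac14\bigl(\sum_{v\in V(G)}d(v)^2-|E(G)|\lambda_n\bigr)$, where $d(v)$ is the degree of $v$ and $\lambda_n$ is the largest eigenvalue of the Laplacian (degree matrix minus adjacency matrix). The Max-Cut defect $\mathrm{def}(G)=|E(G)|-\mathrm{MaxCut}(G)$ is the minimum number of edges whose removal makes $G$ bipartite. Fix an orientation of the edges of $G=(V,E)$; the oriented incidence matrix $D$ is the $|V|\times|E|$ matrix with $D_{ve}=+1$ if $v$ is the head of $e$, $-1$ if $v$ is the tail of $e$, and $0$ otherwise. The antisymmetric line graph $\mathcal A(G)$ is the signed graph with vertex set $E(G)$ and signed adjacency matrix $D^{\mathsf T}D-2I$ (nonzero entries are edges, with the entry $\pm1$ as sign). Switching a signed graph at a vertex reverses the signs of all edges incident to it; changing the orientation changes $\mathcal A(G)$ only by switching. The sign of a cycle is the product of its edge signs, and a signed graph is balanced if all its cycles are positive. The frustration index $\ell(\Sigma)$ of a signed graph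 $\Sigma$ is the minimum number of edges whose deletion makes $\Sigma$ balanced (equivalently, the minimum number of negative edges among all switchings of $\Sigma$); it is switching invariant. *)

(* Defs.v *)
From HB Require Import structures.
From mathcomp Require Import all_boot all_order all_algebra.
From mathcomp Require Import boolp classical_sets reals.
From mathcomp Require Import zify.
Set Implicit Arguments.
Unset Strict Implicit.
Unset Printing Implicit Defensive.
Import Order.TTheory GRing.Theory Num.Theory.
Local Open Scope set_scope.
Local Open Scope ring_scope.

Record sgraph := SGraph {
  vertex :> finType;
  adj : rel vertex;
  adj_sym : symmetric adj;
  adj_irr : irreflexive adj }.

Definition edges (G : sgraph) : {set {set G}} :=
  [set [set p.1; p.2] | p in [pred p : G * G | adj p.1 p.2]].

Lemma card_edge (G : sgraph) (e : {set G}) : e \in edges G -> #|e| = 2%N.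
Proof.
case/imsetP=> -[x y]; rewrite inE /= => xy ->; rewrite cards2.
by case: eqP xy => // ->; rewrite adj_irr.
Qed.

Definition edge (G : sgraph) : finType := {e : {set G} | e \in edges G}.

Definition deg (G : sgraph) (v : G) : nat := #|[set w | adj v w]|.

Definition cut (G : sgraph) (S : {set G}) : {set {set G}} :=
  [set e in edges G | #|e :&: S| == 1%N].

Definition maxcut (G : sgraph) : nat := \max_(S : {set G}) #|cut S|.

Definition defect (G : sgraph) : nat := #|edges G| - maxcut G.

Definition laplacian (R : realType) (G : sgraph) : 'M[R]_#|G| :=
  \matrix_(i, j) ((deg (enum_val i))%:R *+ (i == j)
                  - (adj (enum_val i) (enum_val j))%:R).

(* The set of eigenvalues is finite, and nonempty when [G] has a vertex, so
   this supremum is the largest eigenvalue. *)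
Definition lambda_max (R : realType) (G : sgraph) : R :=
  sup [set a : R | eigenvalue (laplacian R G) a]%classic.

Definition spec (R : realType) (G : sgraph) : R :=
  4^-1 * (\sum_(v : G) (deg v)%:R ^+ 2 - #|edges G|%:R * lambda_max R G).

Record orientation (G : sgraph) := Orientation {
  head_of : edge G -> G;
  tail_of : edge G -> G;
  ends_of : forall e : edge G, val e = [set tail_of e; head_of e] }.

Lemma orientation_exists (G : sgraph) : inhabited (orientation G).
Proof.
have P (e : edge G) : exists p : G * G, val e == [set p.1; p.2].
  by case: e => e /= /imsetP[p _ ->]; exists p.
constructor; apply: (@Orientation G (fun e => (xchoose (P e)).2)
  (fun e => (xchoose (P e)).1)).
by move=> e; apply/eqP; exact: (xchooseP (P e)).
Qed.

Definition incidence (G : sgraph) (o : orientation G) (v : G) (e : edge G)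
    : int :=
  if v == head_of o e then 1 else if v == tail_of o e then -1 else 0.

(* A signed graph is given by its signed adjacency matrix: nonzero entries are
   edges, and their values are the signs. *)
Record sigraph := SiGraph {
  svertex :> finType;
  smx : svertex -> svertex -> int;
  smx_sym : forall u v, smx u v = smx v u;
  smx_diag : forall v, smx v v = 0;
  smx_val : forall u v, smx u v \in [:: 0; 1; -1] }.

Section Underlying.
Variable S : sigraph.
Definition uadj (u v : S) := smx u v != 0.
Fact uadj_sym : symmetric uadj.
Proof. by move=> u v; rewrite /uadj smx_sym. Qed.
Fact uadj_irr : irreflexive uadj.
Proof. by move=> u; rewrite /uadj smx_diag eqxx. Qed.
Definition underlying : sgraph := SGraph uadj_sym uadj_irr.
End Underlying.

Definition cycle_sign (S : sigraph) (c : seq S) : int :=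
  \prod_(x <- c) smx x (next c x).

(* Size at least 3: a two-vertex [ucycle] traverses a single edge twice. *)
Definition balanced (S : sigraph) : Prop :=
  forall c : seq S, (2 < size c)%N -> ucycle (@adj (underlying S)) c ->
    cycle_sign c = 1.

Section Deletion.
Variables (S : sigraph) (F : {set {set S}}).
Definition deleted_mx (u v : S) : int :=
  if [set u; v] \in F then 0 else smx u v.
Fact deleted_mx_sym u v : deleted_mx u v = deleted_mx v u.
Proof. by rewrite /deleted_mx finset.setUC smx_sym. Qed.
Fact deleted_mx_diag v : deleted_mx v v = 0.
Proof. by rewrite /deleted_mx smx_diag if_same. Qed.
Fact deleted_mx_val u v : deleted_mx u v \in [:: 0; 1; -1].
Proof. by rewrite /deleted_mx; case: ifP => // _; exact: smx_val. Qed.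
Definition delete_edges : sigraph :=
  SiGraph deleted_mx_sym deleted_mx_diag deleted_mx_val.
End Deletion.

(* Deleting every edge leaves a balanced graph, so the default value
   [#|edges (underlying S)|] is itself one of the values minimised over. *)
Definition frustration (S : sigraph) : nat :=
  \big[minn/#|edges (underlying S)|]_(F : {set {set S}} |
      (F \subset edges (underlying S)) && `[< balanced (delete_edges F) >]) #|F|.

Section AntisymmetricLineGraph.
Variables (G : sgraph) (o : orientation G).

(* The entries of [D^T D - 2 I], where [D] is the incidence matrix. *)
Definition line_mx (e f : edge G) : int :=
  \sum_(v : G) incidence o v e * incidence o v f - 2 *+ (e == f).

Fact head_neq_tail (e : edge G) : head_of o e != tail_of o e.
Proof.
apply/eqP => ht; have := card_edge (valP e).
by rewrite (ends_of o) ht finset.setUid cards1.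
Qed.

Fact line_mx_sym e f : line_mx e f = line_mx f e.
Proof.
rewrite /line_mx (eq_sym f); congr (_ - _).
by apply: eq_bigr => v _; rewrite mulrC.
Qed.

Fact line_mxE e f : line_mx e f =
  (head_of o e == head_of o f)%:R - (head_of o e == tail_of o f)%:R
  - (tail_of o e == head_of o f)%:R + (tail_of o e == tail_of o f)%:R
  - 2 *+ (e == f).
Proof.
have I v g : incidence o v g = (v == head_of o g)%:R - (v == tail_of o g)%:R.
  rewrite /incidence; case: eqP => [->|_]; last by case: eqP.
  by rewrite (negbTE (head_neq_tail g)).
rewrite /line_mx; congr (_ - _).
have S (x y : G) : \sum_(v : G) ((v == x)%:R * (v == y)%:R : int) = (x == y)%:R.
  rewrite (bigD1 x) //= eqxx mul1r big1 ?addr0 // => v /negbTE ->.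
  by rewrite mul0r.
under eq_bigr => v _ do rewrite !I mulrBl !mulrBr opprB.
by rewrite !big_split /= !sumrN !S; lia.
Qed.

Fact line_mx_diag e : line_mx e e = 0.
Proof.
rewrite line_mxE !eqxx (eq_sym (tail_of _ _) (head_of _ _)).
by rewrite (negbTE (head_neq_tail e)).
Qed.

Fact line_mx_val e f : line_mx e f \in [:: 0; 1; -1].
Proof.
have [<-|ef] := eqVneq e f; first by rewrite line_mx_diag.
have nef : val e != val f by [].
rewrite line_mxE (negbTE ef).
have he := head_neq_tail e; have hf := head_neq_tail f.
move: nef; rewrite (ends_of o e) (ends_of o f).
move: he hf; set a := head_of o e; set b := tail_of o e.
set c := head_of o f; set d := tail_of o f.
move=> ab cd neq.
have acbd : ~~ ((a == c) && (b == d)).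
  by apply: contra neq => /andP[/eqP -> /eqP ->].
have adbc : ~~ ((a == d) && (b == c)).
  by apply: contra neq => /andP[/eqP -> /eqP ->]; rewrite finset.setUC.
have acad : ~~ ((a == c) && (a == d)).
  by apply: contra cd => /andP[/eqP <- /eqP <-].
have bcbd : ~~ ((b == c) && (b == d)).
  by apply: contra cd => /andP[/eqP <- /eqP <-].
have acbc : ~~ ((a == c) && (b == c)).
  by apply: contra ab => /andP[/eqP -> /eqP ->].
have adbd : ~~ ((a == d) && (b == d)).
  by apply: contra ab => /andP[/eqP -> /eqP ->].
move: acbd adbc acad bcbd acbc adbd.
by case: (a == c); case: (a == d); case: (b == c); case: (b == d).
Qed.

Definition antisym_line_graph : sigraph :=
  SiGraph line_mx_sym line_mx_diag line_mx_val.
End AntisymmetricLineGraph.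

(* The conjunct [i != j] only matters for [n = 1]; for [n >= 3] this is the
   cycle on [n] vertices. *)
Section CycleGraph.
Variable n : nat.
Definition cycle_adj (i j : 'I_n) := (i != j) && ((ordS i == j) || (ordS j == i)).
Fact cycle_adj_sym : symmetric cycle_adj.
Proof. by move=> i j; rewrite /cycle_adj eq_sym orbC. Qed.
Fact cycle_adj_irr : irreflexive cycle_adj.
Proof. by move=> i; rewrite /cycle_adj eqxx. Qed.
Definition cycle_graph : sgraph := SGraph cycle_adj_sym cycle_adj_irr.
End CycleGraph.

(* Main.v *)
(* The edges of the cycle are e_i = {i, i+1}, and up to the switching signs
   s_i given by the orientation, consecutive edges are joined in the line graph
   by the sign -1: the entry is - s_i s_(i+1).  Around an odd cycle these
   entries multiply to -1, so the line graph is unbalanced, while after deleting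
   the edge between e_(n-1) and e_0 it is switched to an all-positive graph by
   (-1)^i s_i.  The same product around the cycle shows that no cut contains
   all the edges.

   For an eigenvalue a of the Laplacian with eigenvector x and x_l <> 0, the
   symmetrised sequence z_j = x_(l+j) + x_(l-j) satisfies
   z_(j+2) = (2 - a) z_(j+1) - z_j and z_1 = (2 - a) z_0 / 2, so that z_j/z_0 is
   (-1)^j cos (j t) with 2 cos t = a - 2.  Periodicity z_n = z_0 with n odd
   forces cos (n t) = -1, which excludes a > 2 + 2 cos (pi / n).  This bound is
   attained by (-1)^j cos (j pi / n).  Finally 1 - cos x <= x^2 / 2 and pi < 4
   give spec (C_n) <= 4 / n. *)
Require Import Defs.
From mathcomp Require Import all_boot all_order all_algebra.
From mathcomp Require Import classical_sets reals topology normedtype sequences trigo.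
From mathcomp Require Import boolp derive zify ring lra.
Import Order.TTheory GRing.Theory Num.Theory.
Import numFieldNormedType.Exports.
Local Open Scope ring_scope.

(** * Neighbours, degrees and edges of the cycle *)

Lemma ordS_neq m (i : 'I_m.+2) : ordS i != i.
Proof.
apply/eqP => /(congr1 val) /= h; have := ltn_ord i; rewrite leq_eqVlt => /orP[/eqP e|l].
  by move: h; rewrite e modnn => h; rewrite -h in e.
by move: h; rewrite modn_small //; lia.
Qed.

(** This is where [n >= 3] enters: it keeps the two neighbours of a vertex distinct and the edges
    {i, i+1} pairwise different. *)
Lemma ordSS_neq m (i : 'I_m.+3) : ordS (ordS i) != i.
Proof.
apply/eqP => /(congr1 val) /=; rewrite -addn1 modnDml addn1.
case: (leqP i.+3 m.+3) => l; first by rewrite modn_small //; lia.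
have l' := ltn_ord i.
by rewrite -(subnK (_ : m.+3 <= i.+2)%N) // modnDr modn_small; lia.
Qed.

Lemma cycle_adjE m (i j : cycle_graph m.+3) :
  adj i j = (j == ordS i) || (j == ord_pred i).
Proof.
rewrite /adj /= /cycle_adj (eq_sym j) (eq_sym j) -(inj_eq (@ordS_inj _) (ord_pred i)).
rewrite ord_predK (eq_sym i (ordS j)).
have [->|//] := eqVneq i j; by rewrite (negbTE (ordS_neq _ j)).
Qed.

Lemma ordS_neq_pred m (i : 'I_m.+3) : ordS i != ord_pred i.
Proof. by rewrite -(inj_eq (@ordS_inj _)) ord_predK ordSS_neq. Qed.

Lemma deg_cycle m (i : cycle_graph m.+3) : deg i = 2%N.
Proof.
rewrite /deg; have -> : [set w | adj i w] = [set ordS i; ord_pred i].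
  by apply/setP => w; rewrite !inE cycle_adjE.
by rewrite cards2 ordS_neq_pred.
Qed.

Lemma cycle_edge_subproof m (i : 'I_m.+3) :
  [set i; ordS i] \in edges (cycle_graph m.+3).
Proof.
have a : @adj (cycle_graph m.+3) i (ordS i) by rewrite cycle_adjE eqxx.
by apply/imsetP; exists (i, ordS i).
Qed.

Definition cycle_edge m (i : 'I_m.+3) : edge (cycle_graph m.+3) :=
  exist _ [set i; ordS i] (cycle_edge_subproof m i).
Arguments cycle_edge {m}.

Lemma cycle_edge_inj m : injective (@cycle_edge m).
Proof.
move=> i j /(congr1 val) /= /setP h.
have := h i; have := h j; rewrite !inE !eqxx /= (eq_sym j i).
have [//|/= _ /eqP -> /esym/eqP e] := eqVneq i j.
by move/eqP: (ordSS_neq _ i); rewrite {2}e.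
Qed.

Lemma cycle_edge_surj m (e : edge (cycle_graph m.+3)) : exists i, e = cycle_edge i.
Proof.
case: e => e he; case/imsetP: (he) => -[x y] h E.
have {}h : @adj (cycle_graph m.+3) x y := h; rewrite cycle_adjE in h.
move: h; have [yE _|_ /= /eqP yE] := eqVneq y (ordS x); rewrite yE in E.
  by exists x; apply: val_inj.
by exists y; apply: val_inj => /=; rewrite E yE ord_predK finset.setUC.
Qed.

Lemma edges_cycle m :
  edges (cycle_graph m.+3) = [set [set i; ordS i] | i : 'I_m.+3].
Proof.
apply/setP => e; apply/idP/imsetP => [he|[i _ ->]]; last exact: cycle_edge_subproof.
have [i E] := cycle_edge_surj m (exist _ e he).
by exists i => //; exact: (congr1 val E).
Qed.

Lemma card_edges_cycle m : #|edges (cycle_graph m.+3)| = m.+3.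
Proof.
rewrite edges_cycle card_imset ?card_ord // => i j h.
by apply: cycle_edge_inj; apply: val_inj.
Qed.

(** * Max-Cut defect of an odd cycle *)

Lemma prod_ordS (A : comNzRingType) n (f : 'I_n -> A) :
  \prod_i f (ordS i) = \prod_i f i.
Proof. by rewrite [RHS](reindex_inj (@ordS_inj n)). Qed.

(** Each [f i] occurs twice around the cycle, so only the [n] factors -1 survive. This parity
    obstruction serves both the cuts and the line graph. *)
Lemma prod_mulN1_ordS n (f : 'I_n -> int) :
  odd n -> (forall i, f i ^+ 2 = 1) -> \prod_i - (f i * f (ordS i)) = -1.
Proof.
move=> on f2; rewrite prodrN big_split /= prod_ordS card_ord -signr_odd on expr1.
by rewrite -big_split /= big1 ?mulr1 // => i _; rewrite -expr2.
Qed.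

Lemma mem_cut_cycle m (S : {set cycle_graph m.+3}) (i : 'I_m.+3) :
  ([set i; ordS i] \in Defs.cut S) = ((i \in S) != (ordS i \in S)).
Proof.
rewrite inE cycle_edge_subproof /=.
have := ordS_neq _ i; rewrite eq_sym => /negbTE ne.
rewrite finset.setIUl cardsU.
rewrite (_ : [set i] :&: S :&: ([set ordS i] :&: S) = finset.set0); last first.
  apply/setP => x; rewrite !inE; apply/negbTE/negP => /andP[/andP[/eqP -> _]].
  by rewrite ne.
have c x : #|[set x] :&: S| = (x \in S).
  have [xS|xS] := boolP (x \in S).
    by rewrite (finset.setIidPl _) ?cards1 // finset.sub1set.
  by apply/eqP; rewrite cards_eq0 setI_eq0 disjoints1 xS.
by rewrite !c cards0 subn0; case: (i \in S); case: (ordS i \in S).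
Qed.

Lemma defect_odd_cycle m : odd m.+3 -> defect (cycle_graph m.+3) = 1%N.
Proof.
move=> om; suff E : maxcut (cycle_graph m.+3) = m.+2.
  by rewrite /defect card_edges_cycle E subSnn.
apply/eqP; rewrite eqn_leq; apply/andP; split.
  apply/bigmax_leqP => S _; rewrite -ltnS -[X in (_ < X)%N](card_edges_cycle m).
  apply: proper_card; rewrite properE; apply/andP; split.
    by apply/fintype.subsetP => e; rewrite inE => /andP[].
  (* If every edge were cut, the signs of membership in [S] would alternate, making each factor of
     the product 1 instead of giving -1 overall. *)
  apply/negP => /fintype.subsetP h.
  have := prod_mulN1_ordS _ (fun i : 'I_m.+3 => (-1) ^+ (i \in S)) om.
  rewrite big1 => [E|i _]; first by have := E (fun i => sqrr_sign _ _).
  have := h _ (cycle_edge_subproof m i); rewrite mem_cut_cycle.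
  by case: (i \in S); case: (ordS i \in S).
(* The odd vertices cut every edge {i, i+1} with [i < n - 1]; only the closing edge, between the
   even vertices [n - 1] and 0, is missed. *)
pose S : {set cycle_graph m.+3} := [set i : 'I_m.+3 | odd i].
apply: (leq_trans _ (leq_bigmax S)) => /=.
have inj : injective (fun i : 'I_m.+2 =>
  [set widen_ord (leqnSn _) i; ordS (widen_ord (leqnSn _) i)] : {set cycle_graph m.+3}).
  move=> i j h; have /(congr1 val) /= : widen_ord (leqnSn _) i = widen_ord (leqnSn _) j.
    by apply: cycle_edge_inj; apply: val_inj.
  exact: val_inj.
rewrite -{1}(card_ord m.+2) -(card_imset _ inj).
apply: subset_leq_card; apply/fintype.subsetP => _ /imsetP[i _ ->].
rewrite mem_cut_cycle !inE /= modn_small; last exact: ltn_ord i.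
by rewrite /=; case: odd.
Qed.

(** * Signed adjacency of the line graph of a cycle *)

(** The switching sign s_i: whether the orientation directs edge i from [i] to [i + 1]. *)
Definition cycle_orient {m} (o : orientation (cycle_graph m.+3)) (i : 'I_m.+3)
    : int :=
  if head_of o (cycle_edge i) == ordS i then 1 else -1.

Lemma cycle_orient_sqr m (o : orientation (cycle_graph m.+3)) i :
  cycle_orient o i ^+ 2 = 1.
Proof. by rewrite /cycle_orient; case: ifP. Qed.

Lemma incidence_cycle m (o : orientation (cycle_graph m.+3)) v i :
  incidence o v (cycle_edge i) =
  cycle_orient o i * ((v == ordS i)%:R - (v == i)%:R).
Proof.
have ht := head_neq_tail o (cycle_edge i).
have /setP E := ends_of o (cycle_edge i).
move: (E (head_of o (cycle_edge i))) (E (tail_of o (cycle_edge i))) ht.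
rewrite /incidence /cycle_orient !inE !eqxx orbT /=.
have ne : (i == ordS i) = false by rewrite eq_sym (negbTE (ordS_neq _ _)).
have : ~~ ((v == i) && (v == ordS i)).
  by apply/negP => /andP[/eqP ->]; rewrite ne.
move=> vi /orP[] /eqP -> /orP[] /eqP ->; rewrite ?eqxx // ?ne => _; move: vi;
  by case: (v == i); case: (v == ordS i).
Qed.

Lemma line_mx_cycle m (o : orientation (cycle_graph m.+3)) i j :
  line_mx o (cycle_edge i) (cycle_edge j) =
  - (cycle_orient o i * cycle_orient o j) *
    ((ordS i == j)%:R + (ordS j == i)%:R).
Proof.
rewrite /line_mx; under eq_bigr do rewrite !incidence_cycle.
have S (x y : cycle_graph m.+3) :
    \sum_(v : cycle_graph m.+3) ((v == x)%:R * (v == y)%:R : int) = (x == y)%:R.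
  rewrite (bigD1 x) //= eqxx mul1r big1 ?addr0 // => v /negbTE ->.
  by rewrite mul0r.
under eq_bigr => v _ do rewrite mulrACA.
rewrite -mulr_sumr; under eq_bigr => v _ do rewrite mulrBl !mulrBr.
rewrite !sumrB !S (inj_eq (@ordS_inj _)) (inj_eq (@cycle_edge_inj _)).
have [<-|_] := eqVneq i j.
  by rewrite -expr2 cycle_orient_sqr (eq_sym i) (negbTE (ordS_neq _ _)).
by rewrite (eq_sym i) mulr0n /=; ring.
Qed.

(** * Frustration index of the line graph of an odd cycle *)

Lemma val_iter_ordS n (i : 'I_n) k : val (iter k (@ordS n) i) = ((i + k) %% n)%N.
Proof.
elim: k => [|k IH]; first by rewrite addn0 modn_small.
by rewrite iterS /= IH -addn1 modnDml addn1 addnS.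
Qed.

Lemma traject_ordS n : traject (@ordS n.+1) ord0 n.+1 = enum 'I_n.+1.
Proof.
apply: (inj_map val_inj); rewrite val_enum_ord.
apply: (@eq_from_nth _ 0%N) => [|i]; rewrite size_map size_traject ?size_iota // => i_lt.
rewrite (nth_map ord0) ?size_traject // nth_traject // nth_iota //.
by rewrite val_iter_ordS modn_small.
Qed.

Lemma fcycle_enum_ord n : fcycle (@ordS n.+1) (enum 'I_n.+1).
Proof.
rewrite -traject_ordS /cycle trajectS.
have E : iter n (@ordS n.+1) (ordS ord0) = ord0.
  by apply: val_inj; rewrite -iterSr val_iter_ordS modnn.
by rewrite -[X in rcons _ X]E -trajectSr fpath_traject.
Qed.

(** Along a cycle [next] permutes the vertices, so each [t u] enters the sign twice and cancels. *)
Lemma balanced_switching (S : sigraph) (t : S -> int) :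
  (forall u, t u ^+ 2 = 1) ->
  (forall u v, smx u v != 0 -> smx u v = t u * t v) -> balanced S.
Proof.
move=> t2 h c _ /andP[cc uc]; rewrite /cycle_sign.
transitivity (\prod_(x <- c) (t x * t (next c x))).
  rewrite !big_seq; apply: eq_bigr => x xc; apply: h.
  exact: (next_cycle cc xc).
rewrite big_split /= -[X in _ * X](big_map (next c) predT t).
rewrite [X in _ * X](perm_big c) /=.
  by rewrite -big_split /= big1 // => x _; rewrite -expr2.
have un : uniq (map (next c) c) by rewrite map_inj_uniq //; apply: can_inj (prev_next uc).
have [] := uniq_min_size un (s2 := c); last by move=> _; apply: uniq_perm.
  by move=> _ /mapP[y yc ->]; rewrite mem_next.
by rewrite size_map.
Qed.

Lemma frustration_odd_cycle m (o : orientation (cycle_graph m.+3)) :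
  odd m.+3 -> frustration (antisym_line_graph o) = 1%N.
Proof.
move=> om; set S := antisym_line_graph o.
have t2 := cycle_orient_sqr _ o.
have t0 i : cycle_orient o i != 0 by rewrite -sqrf_eq0 t2.
have consec i : smx (s := S) (cycle_edge i) (cycle_edge (ordS i)) =
    - (cycle_orient o i * cycle_orient o (ordS i)).
  by rewrite [LHS]line_mx_cycle eqxx (negbTE (ordSS_neq _ _)) addr0 mulr1.
have consec0 i : smx (s := S) (cycle_edge i) (cycle_edge (ordS i)) != 0.
  by rewrite consec oppr_eq0 mulf_neq0.
have unbal : ~ balanced S.
  move=> bal.
  pose c : seq S := map cycle_edge (enum 'I_m.+3).
  have uc : ucycle (adj (s := underlying S)) c.
    rewrite /ucycle map_inj_uniq ?enum_uniq; last exact: cycle_edge_inj.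
    rewrite andbT cycle_map; apply: sub_cycle (fcycle_enum_ord _) => i j /eqP <-.
    exact: consec0.
  have := bal c _ uc; rewrite size_map size_enum_ord => /(_ isT).
  rewrite /cycle_sign big_map big_enum /=.
  under eq_bigr => i _.
    rewrite (next_map (@cycle_edge_inj m)) ?enum_uniq //.
    have /eqP <- := next_cycle (fcycle_enum_ord _) (mem_enum 'I_m.+3 i).
    rewrite [line_mx _ _ _]consec; over.
  by rewrite [LHS](prod_mulN1_ordS _ _ om t2).
(* Rules out the empty deletion set, hence the value 0. *)
have del0 : ~ balanced (delete_edges (S := S) finset.set0).
  move=> bal; apply: unbal => c sc uc; rewrite -(bal c sc).
    by apply: eq_bigr => x _; rewrite /= /deleted_mx finset.in_set0.
  have E : adj (s := underlying (delete_edges (S := S) finset.set0)) =2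
      adj (s := underlying S).
    by move=> x y; rewrite /= /uadj /= /deleted_mx finset.in_set0.
  by rewrite /ucycle (eq_cycle E).
pose F : {set {set S}} := [set [set cycle_edge (ord_max : 'I_m.+3); cycle_edge ord0]].
have E0 : ordS ord_max = ord0 :> 'I_m.+3 by apply: val_inj; rewrite /= modnn.
have FE : F \subset edges (underlying S).
  rewrite finset.sub1set -E0; apply/imsetP.
  by exists (cycle_edge ord_max, cycle_edge (ordS ord_max)) => //; exact: consec0.
have balF : balanced (delete_edges F).
  (* The index of an edge is recovered by [pick]; the default 1 is never reached, since every edge
     is some [cycle_edge i]. *)
  pose t (e : S) : int :=
    if [pick i | cycle_edge i == e] is Some i then (-1) ^+ i * cycle_orient o i else 1.
  have tE i : t (cycle_edge i) = (-1) ^+ i * cycle_orient o i.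
    rewrite /t; case: pickP => [j /eqP /cycle_edge_inj -> //|/(_ i)].
    by rewrite eqxx.
  have step i : [set cycle_edge i; cycle_edge (ordS i)] \notin F ->
      smx (s := S) (cycle_edge i) (cycle_edge (ordS i)) =
      t (cycle_edge i) * t (cycle_edge (ordS i)).
    (* The index wraps around only at [ord_max], and that edge of the line graph is the deleted one;
       elsewhere the parity of the index flips and absorbs the sign -1. *)
    have [->|iN] := eqVneq i ord_max; first by rewrite E0 finset.in_set1 eqxx.
    have i_lt : (i.+1 < m.+3)%N.
      by have := ltn_ord i; rewrite leq_eqVlt => /orP[/eqP [e]|//];
        case/eqP: iN; exact: val_inj.
    rewrite consec !tE /= modn_small // exprS mulN1r mulrACA mulrN -expr2.
    by rewrite sqrr_sign mulN1r.
  apply: (balanced_switching (delete_edges F) t) => [u|u v].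
    have [i ->] := cycle_edge_surj _ u.
    by rewrite tE exprMn t2 mulr1 sqrr_sign.
  have [i ->] := cycle_edge_surj _ u; have [j ->] := cycle_edge_surj _ v.
  rewrite /= /deleted_mx; case: ifPn => [_|nF nz]; first by rewrite eqxx.
  have : (ordS i == j) || (ordS j == i).
    apply: contraNT nz => /norP[/negbTE n1 /negbTE n2].
    by rewrite [smx _ _]line_mx_cycle n1 n2 addr0 mulr0.
  case/orP => /eqP e; subst; first exact: step.
  by rewrite smx_sym mulrC; apply: step; rewrite finset.setUC.
have cF : #|F| = 1%N by rewrite cards1.
apply/eqP; rewrite eqn_leq /frustration -minEnat; apply/andP; split.
  rewrite -[X in (_ <= X)%N]cF.
  apply: (@bigmin_le_cond _ nat _ _ F _ (fun F : {set {set S}} => #|F|)).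
  by rewrite FE; apply/asboolP.
(* The default value of the minimum must also be at least 1; the edge in [F] witnesses this. *)
apply/(@bigmin_geP _ nat); split; first by have := subset_leq_card FE; rewrite cF.
move=> F' /andP[_ /asboolP b]; rewrite leEnat lt0n cards_eq0.
by apply: contra_notN del0 => /eqP <-.
Qed.

(** * Laplacian eigenvalues as equations on vertices *)

Lemma laplacianE (R : realType) (G : sgraph) (x : G -> R) (v : G) :
  ((\row_i x (enum_val i)) *m laplacian R G) 0 (enum_rank v) =
  (deg v)%:R * x v - \sum_(w | adj v w) x w.
Proof.
rewrite mxE.
transitivity (\sum_w x w * ((deg w)%:R *+ (w == v) - (adj w v)%:R)).
  rewrite [RHS](reindex (@enum_val G G)) /=; last first.
    by apply: onW_bij; exact: enum_val_bij.
  by apply: eq_bigr => i _; rewrite !mxE enum_rankK -(inj_eq enum_val_inj) enum_rankK.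
under eq_bigr => w _ do rewrite mulrBr.
rewrite sumrB (bigD1 v) //= eqxx mulr1n mulrC big1 => [|w /negbTE ->]; last first.
  by rewrite mulr0n mulr0.
rewrite addr0 [in RHS]big_mkcond; congr (_ - _); apply: eq_bigr => w _.
by rewrite adj_sym; case: adj; rewrite ?mulr1 ?mulr0.
Qed.

(** Replaces row vectors indexed through [enum_val] by functions on the vertices. *)
Lemma eigenvalue_laplacianP (R : realType) (G : sgraph) (a : R) :
  eigenvalue (laplacian R G) a <->
  exists2 x : G -> R, exists v, x v != 0
    & forall v, (deg v)%:R * x v - \sum_(w | adj v w) x w = a * x v.
Proof.
split=> [/eigenvalueP[y ya y0]|[x [v xv] xa]].
  pose x v := y 0 (enum_rank v).
  have yE : y = \row_i x (enum_val i) by apply/rowP => i; rewrite mxE /x enum_valK.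
  exists x => [|v]; last by rewrite -laplacianE -yE ya mxE.
  have /rV0Pn[i yi] := y0.
  by exists (enum_val i); rewrite /x enum_valK.
apply/eigenvalueP; exists (\row_i x (enum_val i)).
  by apply/rowP => i; rewrite -(enum_valK i) laplacianE xa !mxE enum_rankK.
by apply/rV0Pn; exists (enum_rank v); rewrite mxE enum_rankK.
Qed.

Lemma sum_adj_cycle (R : realType) m (x : cycle_graph m.+3 -> R) i :
  \sum_(w | adj i w) x w = x (ordS i) + x (ord_pred i).
Proof.
rewrite (eq_bigl (fun w => w \in [set ordS i; ord_pred i])); last first.
  by move=> w; rewrite cycle_adjE !inE.
by rewrite big_setU1 ?big_set1 // finset.in_set1 ordS_neq_pred.
Qed.

(** * Largest Laplacian eigenvalue of an odd cycle *)

(** The three-term recurrence of cosine along a progression of step [y]. *)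
Lemma cosD_cosB (R : realType) (x y : R) : cos (x + y) + cos (x - y) = 2 * cos y * cos x.
Proof. by rewrite cosD cosB; ring. Qed.

(* Since [n] is odd, [cos] changes sign exactly as [(-1) ^+ j] does when [j]
   increases by [n], so this sequence descends to the vertices of the cycle. *)
Definition alt_cos {R : realType} n (j : nat) : R := (-1) ^+ j * cos (j%:R * (pi / n%:R)).

Lemma alt_cosD n (R : realType) j : odd n -> alt_cos n (j + n) = alt_cos n j :> R.
Proof.
move=> on; have n0 : n%:R != 0 :> R by rewrite pnatr_eq0; case: n on.
rewrite /alt_cos natrD mulrDl (mulrCA n%:R) divff // mulr1 cosDpi.
by rewrite exprD -(signr_odd _ n) on expr1; ring.
Qed.

Lemma alt_cos_mod n (R : realType) j : odd n -> alt_cos n (j %% n) = alt_cos n j :> R.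
Proof.
move=> on; rewrite [in RHS](divn_eq j n) addnC; elim: (j %/ n)%N => [|q IH].
  by rewrite addn0.
by rewrite mulSn addnCA addnC alt_cosD.
Qed.

Lemma eigenvalue_odd_cycle (R : realType) m : odd m.+3 ->
  eigenvalue (laplacian R (cycle_graph m.+3)) (2 + 2 * cos (pi / m.+3%:R)).
Proof.
move=> om; apply/eigenvalue_laplacianP; exists (fun i : 'I_m.+3 => alt_cos m.+3 i).
  by exists ord0; rewrite /alt_cos mul0r cos0 mulr1 oner_neq0.
move=> i; rewrite deg_cycle sum_adj_cycle /= !alt_cos_mod //.
(* Shifting the indices [i] and [i + 1] by [n] makes the three indices consecutive, [j], [j + 1],
   [j + 2], with no reduction modulo [n]. *)
rewrite -(alt_cosD m.+3 _ i) // -(alt_cosD m.+3 _ i.+1) //.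
rewrite !addnS !addSn /=; move: (i + m).+2%N => j.
rewrite /alt_cos !exprS -(natr1 j.+1) -(natr1 j).
set t := pi / _; set y := (j%:R + 1) * t.
have -> : (j%:R + 1 + 1) * t = y + t by rewrite /y; ring.
have -> : j%:R * t = y - t by rewrite /y; ring.
have := cosD_cosB R y t; set A := cos (y + t); set B := cos (y - t) => h.
have -> : A = 2 * cos t * cos y - B by rewrite -h addrK.
by ring.
Qed.

(* For [b < 2] the recurrence gives [w j = cos (j * acos (b / 2))] with
   [n * acos (b / 2) < pi]; for [2 <= b] it is nondecreasing from [w 0 = 1]. *)
Lemma cos_recurrence (R : realType) (w : nat -> R) (b : R) n :
  (0 < n)%N -> w 0 = 1 -> w 1 = b / 2 -> (forall j, w j.+2 = b * w j.+1 - w j) ->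
  2 * cos (pi / n%:R) < b -> -1 < w n.
Proof.
move=> n0 w0 w1 wS hb; have [b2|b2] := leP 2 b.
  suff h j : 1 <= w j <= w j.+1 by have /andP[h1 _] := h n; lra.
  elim: j => [|j /andP[h1 h2]]; first by rewrite w0 w1 lexx /=; lra.
  (* The next increment is [(b - 2) * w j.+1] plus the previous increment, both nonnegative. *)
  by rewrite wS (le_trans h1 h2) /=; nra.
have n0' : 0 < n%:R :> R by rewrite ltr0n.
have n1 : 1 <= n%:R :> R by rewrite ler1n.
have c1 := cos_geN1 (pi / n%:R : R).
have bI : -1 <= b / 2 <= 1 by lra.
pose t := acos (b / 2).
have ct : cos t = b / 2 by apply: acosK; rewrite in_itv.
have t0 : 0 <= t by exact: acos_ge0.
have wE j : w j = cos (j%:R * t) /\ w j.+1 = cos (j.+1%:R * t).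
  elim: j => [|j [IH1 IH2]]; first by rewrite w0 w1 mul0r cos0 mul1r ct.
  split=> //; rewrite wS IH1 IH2.
  have -> : j%:R * t = j.+1%:R * t - t by rewrite -natr1; ring.
  have -> : j.+2%:R * t = j.+1%:R * t + t by rewrite -(natr1 j.+1); ring.
  have := cosD_cosB R (j.+1%:R * t) t.
  by rewrite ct => /(canRL (addrK _)) ->; congr (_ - _); field.
have tpi : t < pi / n%:R.
  have pp : 0 <= (pi : R) / n%:R <= pi.
    by rewrite divr_ge0 ?pi_ge0 ?ler0n //= ler_pdivrMr // ler_peMr ?pi_ge0.
  rewrite -(@ltr_cos R) ?in_itv //=; first by rewrite ct; lra.
  by rewrite t0 acos_lepi.
rewrite (wE n).1 -cospi ltr_cos ?in_itv /= ?pi_ge0 ?lexx //.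
  by rewrite mulrC -ltr_pdivlMr.
by rewrite mulr_ge0 //= ltW // mulrC -ltr_pdivlMr.
Qed.

Lemma eigenvalue_odd_cycle_le (R : realType) m (a : R) : odd m.+3 ->
  eigenvalue (laplacian R (cycle_graph m.+3)) a -> a <= 2 + 2 * cos (pi / m.+3%:R).
Proof.
move=> om /eigenvalue_laplacianP[x [l xl] xa].
pose z j := x (iter j (@ordS _) l) + x (iter j (@ord_pred _) l).
have rec i : x (ordS i) + x (ord_pred i) = (2 - a) * x i.
  by have := xa i; rewrite deg_cycle sum_adj_cycle => /esym h; rewrite mulrBl h; ring.
have zS j : z j.+2 = (2 - a) * z j.+1 - z j.
  rewrite /z mulrDr -!rec !iterS ordSK ord_predK.
  ring.
(* Dividing by [z 0 = 2 * x l] normalises [w 0] to 1, and the alternating sign turns the coefficient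
   [2 - a] into [a - 2]. *)
pose w j := (-1) ^+ j * z j / (2 * x l).
have d0 : 2 * x l != 0 by rewrite mulf_neq0 // pnatr_eq0.
rewrite leNgt; apply/negP => ha.
have : -1 < w m.+3.
  apply: (@cos_recurrence _ w (a - 2)) => //; last by lra.
  - by rewrite /w /z /=; field.
  - by rewrite /w /z /= rec expr1; field.
  - by move=> j; rewrite /w zS !exprS; field.
have iterl : iter m.+3 (@ordS _) l = l.
  by apply: val_inj; rewrite val_iter_ordS modnDr modn_small.
rewrite /w /z iterl.
have iterK j : iter j (@ord_pred _) (iter j (@ordS _) l) = l.
  by elim: j => // j IH; rewrite iterSr iterS ordSK.
have -> : iter m.+3 (@ord_pred _) l = l by rewrite -[RHS](iterK m.+3) iterl.
(* Both walks are back at [l] after [n] steps, and [n] is odd, so [w n = -1]. *)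
rewrite -signr_odd om expr1 (_ : _ / _ = -1) ?ltxx //; by field.
Qed.

Lemma lambda_max_odd_cycle (R : realType) m : odd m.+3 ->
  lambda_max R (cycle_graph m.+3) = 2 + 2 * cos (pi / m.+3%:R).
Proof.
move=> om; apply/eqP; rewrite eq_le; apply/andP; split.
  apply: ge_sup; first by eexists; exact: eigenvalue_odd_cycle.
  by move=> a; exact: eigenvalue_odd_cycle_le.
apply: ub_le_sup; last exact: eigenvalue_odd_cycle.
by exists (2 + 2 * cos (pi / m.+3%:R)) => a; exact: eigenvalue_odd_cycle_le.
Qed.

(** * Closed form of spec and upper bounds for it *)

Lemma spec_odd_cycle (R : realType) m : odd m.+3 ->
  spec R (cycle_graph m.+3) = m.+3%:R / 2 * (1 - cos (pi / m.+3%:R)).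
Proof.
move=> om; rewrite /spec lambda_max_odd_cycle // card_edges_cycle.
under eq_bigr => v _ do rewrite deg_cycle.
rewrite sumr_const card_ord -mulr_natl; by field.
Qed.

(** By the mean value theorem sin x = x cos c for some c, and cos c squared is at most 1. *)
Lemma sin_sqr_le (R : realType) (x : R) : 0 <= x -> sin x ^+ 2 <= x ^+ 2.
Proof.
move=> x0.
have [c _] := MVT_segment x0 (fun y _ => is_derive_sin y)
  (continuous_subspaceT (@continuous_sin R)).
rewrite sin0 !subr0 => ->; rewrite exprMn ler_piMl ?sqr_ge0 //.
by rewrite -(cos2Dsin2 c) lerDl sqr_ge0.
Qed.

Lemma one_sub_cos_le (R : realType) (x : R) : 0 <= x -> 1 - cos x <= x ^+ 2 / 2.
Proof.
move=> x0; have x2 : 0 <= x / 2 by lra.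
have xE : x = (x / 2) *+ 2 by rewrite -mulr_natr divfK // pnatr_eq0.
have := sin_sqr_le R _ x2; rewrite [in cos x]xE cos_mulr2n cos2sin2.
by lra.
Qed.

Lemma spec_formula_le (R : realType) n : (0 < n)%N ->
  n%:R / 2 * (1 - cos (pi / n%:R)) <= 4 / n%:R :> R.
Proof.
move=> n0; have n0' : 0 < n%:R :> R by rewrite ltr0n.
have := @one_sub_cos_le R (pi / n%:R) (divr_ge0 (pi_ge0 R) (ltW n0')).
have p0 := pi_ge0 R; have p4 : (pi : R) < 4 by have := pihalf_lt2 R; lra.
have n2 : 0 < n%:R / 2 :> R by lra.
move=> /(ler_wpM2l (ltW n2)) /le_trans; apply.
rewrite (_ : n%:R / 2 * _ = pi ^+ 2 / 4 / n%:R); last by field; lra.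
by rewrite ler_pM2r ?invr_gt0 //; nra.
Qed.

(** For t = pi / 3, the triple-angle formula turns cos (3 t) = -1 into (cos t + 1) (2 cos t - 1)^2 =
    0, and cos t > 0. *)
Lemma cos_pi_third (R : realType) : cos (pi / 3) = 1 / 2 :> R.
Proof.
set t := pi / 3; have p0 := pi_gt0 R.
have : cos (t *+ 2 + t) = -1 by rewrite -cospi /t; congr cos; field.
rewrite cosD cos_mulr2n sin_mulr2n.
have -> : (cos t * sin t) *+ 2 * sin t = 2 * cos t * sin t ^+ 2 by ring.
rewrite sin2cos2 => h.
have : (cos t + 1) * (2 * cos t - 1) ^+ 2 = 0 by nra.
have c0 : cos t + 1 != 0.
  have : 0 < cos t by apply: cos_gt0_pihalf; rewrite /t; lra.
  by lra.
move/eqP; rewrite mulf_eq0 (negbTE c0) sqrf_eq0 => /eqP; lra.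
Qed.

(** The bound 4 / n suffices from n = 5 on; for n = 3 the exact value 3/4 is used. As the
    frustration index is 1, this gives the spectral inequality. *)
Lemma spec_odd_cycle_le1 (R : realType) m : odd m.+3 ->
  spec R (cycle_graph m.+3) <= 1.
Proof.
move=> om; rewrite spec_odd_cycle //.
case: m om => [|[//|m]] _; first by rewrite cos_pi_third; lra.
apply: le_trans (spec_formula_le R _ (ltn0Sn _)) _.
by rewrite ler_pdivrMr ?ltr0n // mul1r ler_nat.
Qed.

(** * The claims for each odd cycle and the limit of spec *)

Theorem proposition10 (R : realType) :
  (forall k : nat, (1 <= k)%N ->
    [/\ defect (cycle_graph (2 * k + 1)) = 1%N,
        (forall o : orientation (cycle_graph (2 * k + 1)),
           frustration (antisym_line_graph o) = 1%N),
        (forall o : orientation (cycle_graph (2 * k + 1)),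
           spec R (cycle_graph (2 * k + 1))
             <= (frustration (antisym_line_graph o))%:R)
      & spec R (cycle_graph (2 * k + 1)) =
          (2 * k + 1)%:R / 2 * (1 - cos (pi / (2 * k + 1)%:R))])
  /\ (spec R (cycle_graph (2 * k + 1)) @[k --> \oo] --> (0 : R))%classic.
Proof.
have nE k : (2 * k.+1 + 1)%N = (2 * k).+3 by lia.
have om k : odd (2 * k).+3 by rewrite /= mul2n odd_double.
split=> [[//|k] _|].
  rewrite nE; split=> [|o|o|].
  - exact: defect_odd_cycle.
  - exact: frustration_odd_cycle.
  - by rewrite frustration_odd_cycle // spec_odd_cycle_le1.
  - exact: spec_odd_cycle.
(* Since [harmonic k] is 1 / (k + 1), it dominates 1 / (2k + 1), so 4 / n squeezes spec to 0. *)
apply: (@squeeze_cvgr _ _ _ R (fun=> 0) (fun k => 4 * harmonic k)); last 2 first.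
- exact: cvg_cst.
- by rewrite -(scaler0 _ (4 : R)); exact: (cvgZl_tmp cvg_harmonic).
(* The closed form was proved for at least 3 vertices, so [k = 0] is set aside. *)
near=> k; have k0 : (0 < k)%N by near: k; exact: nbhs_infty_gt.
rewrite -(prednK k0); move: k.-1 => j; rewrite nE (spec_odd_cycle R _ (om j)) /=.
apply/andP; split.
  by rewrite mulr_ge0 ?divr_ge0 // subr_ge0 cos_le1.
apply: le_trans (spec_formula_le R _ (ltn0Sn _)) _.
by rewrite ler_pM2l // lef_pV2 ?posrE ?ltr0n // ler_nat; lia.
Unshelve. all: by end_near.
Qed.
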